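(* Let $\mathcal H$ be a real Hilbert space, $A:\mathcal H\rightrightarrows\mathcal H$ a maximal monotone operator, $\theta>0$, and assume $S=A^{-1}(0)$ is non-empty. Given $x_0\notin S$, let $(x,\lambda):[0,+\infty[\to\mathcal H\times\mathbb R_{++}$ be the unique global solution of $$\begin{cases}\dot x(t)+x(t)-(I+\lambda(t)A)^{-1}x(t)=0,\quad \lambda(t)>0,\\ \lambda(t)\,\|(I+\lambda(t)A)^{-1}x(t)-x(t)\|=\theta,\\ x(0)=x_0.\end{cases}$$ Then $x(t)$ converges strongly, as $t\to+\infty$, to some $x^*\in A^{-1}(0)$ in each of the following situations: i) $A$ is strongly monotone; ii) $A=\partial f$, where $f:\mathcal H\to\mathbb R\cup\{+\infty\}$ is a proper closed convex function which is boundedly inf-compact; iii) $S=A^{-1}(0)$ has a nonempty interior.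
   Context: $A^{-1}(0)=\{x\in\mathcal H:0\in Ax\}$. $A$ is strongly monotone if there is $\alpha>0$ such that $\langle y_2-y_1,x_2-x_1\rangle\ge\alpha\|x_2-x_1\|^2$ whenever $y_i\in Ax_i$, $i=1,2$. $\partial f$ is the convex subdifferential. $f$ is boundedly inf-compact if for any $R>0$ and $l\in\mathbb R$ the set $\{x\in\mathcal H: f(x)\le l,\ \|x\|\le R\}$ is relatively compact in $\mathcal H$. Existence and uniqueness of the global solution $(x,\lambda)$ (with $x$ of class $\mathscr C^1$ and $\lambda$ locally Lipschitz continuous) holds for every $x_0\notin A^{-1}(0)$. *)

(* Defs.v *)
From HB Require Import structures.
From mathcomp Require Import all_boot all_order all_algebra.
From mathcomp Require Import all_classical all_reals all_analysis.

Set Implicit Arguments.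
Unset Strict Implicit.
Unset Printing Implicit Defensive.

Import Order.TTheory GRing.Theory Num.Theory.
Import numFieldNormedType.Exports.

Local Open Scope classical_set_scope.
Local Open Scope ring_scope.

(* A real Hilbert space is a complete normed space H together with an inner
   product ip whose induced norm is the norm of H. *)
Definition norm_from_inner (R : realType) (H : completeNormedModType R)
    (ip : {dot H for idfun}) : Prop :=
  forall x : H, `|x| = Num.sqrt (ip x x).

Section operators.
Variables (R : realType) (H : completeNormedModType R).
Variable ip : {dot H for idfun}.

(* A set-valued operator H => H is a function H -> set H. *)
Implicit Types (A B : H -> set H) (f : H -> \bar R).

Definition monotone_operator A : Prop :=
  forall x1 x2 y1 y2, A x1 y1 -> A x2 y2 -> 0 <= ip (y2 - y1) (x2 - x1).

Definition maximal_monotone A : Prop :=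
  monotone_operator A /\
  forall B, monotone_operator B ->
    (forall x, A x `<=` B x) -> forall x, B x `<=` A x.

Definition strongly_monotone A : Prop :=
  exists2 alpha : R, 0 < alpha &
    forall x1 x2 y1 y2, A x1 y1 -> A x2 y2 ->
      alpha * `|x2 - x1| ^+ 2 <= ip (y2 - y1) (x2 - x1).

Definition zeros A : set H := [set x | A x 0].

(* The inverse (I + lambda A)^-1 as a set-valued operator; for A maximal
   monotone and lambda > 0 each value is a singleton (Minty), so that
   "z belongs to resolvent A lambda x" reads z = (I + lambda A)^-1 x. *)
Definition resolvent A (lambda : R) (x : H) : set H :=
  [set z | exists2 u, A z u & x = z + lambda *: u].

Definition proper_function f : Prop :=
  (forall x, f x != -oo%E) /\ (exists x, f x != +oo%E).

Definition convex_ereal f : Prop :=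
  forall (x y : H) (t : R), 0 <= t <= 1 ->
    (f (t *: x + (1 - t) *: y)%R <= t%:E * f x + (1 - t)%R%:E * f y)%E.

Definition boundedly_inf_compact f : Prop :=
  forall r l : R, 0 < r -> precompact [set x | (f x <= l%:E)%E /\ `|x| <= r].

Definition subdifferential f : H -> set H :=
  fun x => [set u | forall y, (f x + (ip u (y - x)%R)%:E <= f y)%E].

(* Limit of the difference quotient along D: one-sided at an endpoint of D. *)
Definition has_derivative_within (D : set R) (x : R -> H) (t : R) (v : H) :
    Prop :=
  (s - t)^-1 *: (x s - x t) @[s --> within D t^'] --> v.

(* x and lambda are defined on all of R; only their restrictions to [0, +oo[
   are constrained. *)
Definition global_solution A (theta : R) (x0 : H)
    (x : R -> H) (lambda : R -> R) : Prop :=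
  [/\ exists dx : R -> H,
        [/\ forall t : R, 0 <= t -> has_derivative_within `[0, +oo[ x t (dx t),
            {within `[0, +oo[, continuous dx} &
            forall t : R, 0 <= t -> 0 < lambda t /\
              exists z, [/\ resolvent A (lambda t) (x t) z,
                            dx t + x t - z = 0 &
                            lambda t * `|z - x t| = theta]],
      [locally [lipschitz lambda t | t in `[0, +oo[]] &
      x 0 = x0].

End operators.

(* Main.v *)
Require Import Defs.
From HB Require Import structures.
From mathcomp Require Import all_boot all_order all_algebra.
From mathcomp Require Import all_classical all_reals all_analysis.
From mathcomp Require Import ring lra.
Set Implicit Arguments.
Unset Strict Implicit.
Unset Printing Implicit Defensive.

Import Order.TTheory GRing.Theory Num.Theory.
Import numFieldNormedType.Exports.
Local Open Scope classical_set_scope.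
Local Open Scope ring_scope.

(** Write u(t) for the element of A z(t), with z(t) = x(t) + x'(t) the resolvent
    point, such that x'(t) = - lambda(t) u(t).  Monotonicity of A against a zero
    p gives <x', x - p> <= - |x'|^2, that is,

      d/dt |x(t) - p|^2 <= - 2 |x'(t)|^2.

    Two consequences carry the whole proof.

    - The distance from x(t) to every zero of A is nonincreasing
      ([solution_fejer]).  Hence x(t) converges to a zero q as soon as it comes
      arbitrarily close to q at some times ([fejer_cvg]).
    - The squared speed is integrable, so |x'| is small at arbitrarily late
      times.  The algebraic constraint says theta |u| = |x'|^2, hence at these
      times the points z of the graph of A are close to x while u is close to 0
      ([solution_approx_zeros]).

    By maximality of A, any strong limit of such points z is a zero
    ([zeros_approx]), so in each situation strong compactness is the only issue.

    - If A is strongly monotone, |z - p| <= |u| / alpha for the zero p, and x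
      comes close to p.
    - If A is the subdifferential of f, the points z remain bounded and
      f(z) <= f(p) + |u| |p - z| remains bounded too, so that bounded
      inf-compactness provides a strong cluster point q of the points z; it is
      a zero, and x comes close to q.
    - If the zeros contain a ball around p, the monotonicity of the distances to
      all the points of the ball bounds the displacement |x(t) - x(s)| by the
      decrease of |x - p|^2 ([fejer_displacement]); so x is Cauchy. *)

(** * Inner product *)

Section inner_product.
Context {R : realType} {H : completeNormedModType R}.
Context {ip : {dot H for idfun}} (Hip : norm_from_inner ip).

Lemma ipC a b : ip a b = ip b a.
Proof. by rewrite hermC expr0 mul1r. Qed.

Lemma sqr_norm a : `|a| ^+ 2 = ip a a.
Proof.
rewrite Hip sqr_sqrtr //; have [->|a0] := eqVneq a 0; first by rewrite linear0l.
exact/ltW/neq0_dnorm_gt0.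
Qed.

Lemma sqr_normD a b : `|a + b| ^+ 2 = `|a| ^+ 2 + 2 * ip a b + `|b| ^+ 2.
Proof. by rewrite !sqr_norm linearDl !linearD /= (ipC b a); ring. Qed.

Lemma subr_sqr_norm a b : `|a| ^+ 2 - `|b| ^+ 2 = ip (a - b) (a + b).
Proof. by rewrite !sqr_norm linearBl !linearD /= (ipC b a); ring. Qed.

Lemma ip_le_norm a b : ip a b <= `|a| * `|b|.
Proof.
have : `|a + b| ^+ 2 <= (`|a| + `|b|) ^+ 2 by rewrite lerXn2r ?nnegrE ?ler_normD.
by rewrite sqr_normD; nra.
Qed.

(** By polarization, continuity of the inner product is that of the norm. *)
Lemma cvg_ip (T : Type) (F : set_system T) (FF : Filter F) (f g : T -> H) a b :
  f @ F --> a -> g @ F --> b -> ip (f t) (g t) @[t --> F] --> ip a b.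
Proof.
move=> fa gb.
have polar u v : ip u v = 2^-1 * (`|u + v| ^+ 2 - `|u| ^+ 2 - `|v| ^+ 2).
  by rewrite sqr_normD; field.
under eq_fun do rewrite polar.
rewrite polar; apply: cvgMl_tmp; apply: cvgB; first apply: cvgB.
- by rewrite /GRing.exp /=; apply: cvgM; apply: cvg_norm; apply: cvgD.
- by apply: cvgM; apply: cvg_norm.
- by apply: cvgM; apply: cvg_norm.
Qed.

End inner_product.

(** * Distance from a differentiable curve to a point *)

Section curve.
Context {R : realType} {H : completeNormedModType R}.
Context {ip : {dot H for idfun}} (Hip : norm_from_inner ip).
Variable x : R -> H.

(** The difference x s - x t is the product of the difference quotient, which
    converges, by s - t. *)
Lemma has_derivative_within_cvg (D : set R) (t : R) (v : H) :
  has_derivative_within D x t v -> x s @[s --> within D (nbhs t)] --> x t.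
Proof.
move=> dx; have FF : Filter (within D t^') by exact: within_filter.
have dt0 : (s - t) @[s --> within D t^'] --> (0 : R).
  rewrite -(subrr t); apply: cvgB; last exact: cvg_cst.
  apply: cvg_within_filter; exact: nbhs_dnbhs.
have /cvgrPdist_lt xt : x s @[s --> within D t^'] --> x t.
  have lim : (s - t) *: ((s - t)^-1 *: (x s - x t)) + x t @[s --> within D t^']
      --> x t.
    rewrite -{3}[x t]add0r -(scale0r v).
    by apply: cvgD; [exact: cvgZ | exact: cvg_cst].
  apply: (cvg_trans _ lim); apply: near_eq_cvg.
  rewrite !near_withinE; near=> s => st _ /=.
  by rewrite scalerA divff ?subr_eq0// scale1r subrK.
apply/cvgrPdist_lt => e e0; move: (xt e e0); rewrite !near_withinE.
apply: filterS => s xs Ds.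
by have [->|st] := eqVneq s t; [rewrite subrr normr0|exact: xs].
Unshelve. all: by end_near. Qed.

(** By [subr_sqr_norm], the difference quotient of |x - p|^2 is the inner product
    of the quotient of x with (x s - p) + (x t - p).  Only an interior t is
    covered, since the derivative on the real line is two-sided. *)
Lemma is_derive_sqr_dist (t : R) (v p : H) : 0 < t ->
  has_derivative_within `[0, +oo[ x t v ->
  is_derive t 1 (fun s => `|x s - p| ^+ 2) (2 * ip v (x t - p)).
Proof.
move=> t0 dx.
have xt := has_derivative_within_cvg dx.
have [FF FF'] : Filter (within `[0, +oo[ t^') /\ Filter (within `[0, +oo[ (nbhs t)).
  by split; exact: within_filter.
pose q s := (s - t)^-1 * (`|x s - p| ^+ 2 - `|x t - p| ^+ 2).
have qt : q s @[s --> within `[0, +oo[ t^'] --> 2 * ip v (x t - p).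
  rewrite mulr_natl mulr2n -linearD.
  under eq_fun => s do rewrite /q (subr_sqr_norm Hip) -linearZl_LR /=.
  apply: (cvg_ip Hip).
    by under eq_fun => s do rewrite opprB addrA subrK.
  apply: cvgD; last exact: cvg_cst.
  apply: cvgB; last exact: cvg_cst.
  by move=> B /xt xtB; apply: nbhs_dnbhs.
suff dg : h^-1 *: (`|x (h *: (1 : R) + t) - p| ^+ 2 - `|x t - p| ^+ 2)
    @[h --> 0^'] --> (2 * ip v (x t - p) : R).
  apply: DeriveDef; last exact: cvg_lim.
  by apply/cvg_ex; exists (2 * ip v (x t - p)).
have ht : h *: (1 : R) + t @[h --> 0^'] --> within `[0, +oo[ t^'.
  (* Increments smaller than t keep the curve parameter in the half-line. *)
  move=> B tB.
  have shift_t : h *: (1 : R) + t @[h --> (0 : R)] --> t.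
    suff : h *: (1 : R) + t @[h --> (0 : R)] --> 0 *: (1 : R) + t.
      by rewrite scale0r add0r.
    apply: cvgD; last exact: cvg_cst.
    by apply: cvgZ; [exact: cvg_id | exact: cvg_cst].
  have hB : \forall h \near (0 : R), (h *: (1 : R) + t != t) ->
    `[0, +oo[%classic (h *: (1 : R) + t) -> B (h *: (1 : R) + t).
    exact: shift_t _ tB.
  change (\forall h \near 0^', B (h *: (1 : R) + t)); near=> h.
  have h0 : h != 0 by near: h; exact: nbhs_dnbhs_neq.
  have ht : `|h| < t by near: h; exact: dnbhs0_lt.
  have hBh : (h *: (1 : R) + t != t) ->
    `[0, +oo[%classic (h *: (1 : R) + t) -> B (h *: (1 : R) + t).
    by near: h; exact: nbhs_dnbhs.
  apply: hBh; rewrite /GRing.scale /= mulr1.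
    by rewrite -subr_eq0 addrK.
  by rewrite in_itv /= andbT; move: ht; rewrite ltr_norml; lra.
have := cvg_comp _ _ ht qt.
move=> lim; apply: (cvg_trans _ lim); apply: near_eq_cvg; near=> h.
by rewrite /q /= addrK /GRing.scale /= mulr1.
Unshelve. all: by end_near. Qed.

Lemma within_continuous_sqr_dist (s t : R) (v : R -> H) p : 0 <= s ->
  (forall u, 0 <= u -> has_derivative_within `[0, +oo[ x u (v u)) ->
  {within `[s, t], continuous (fun u => `|x u - p| ^+ 2)}.
Proof.
move=> s0 dx; apply/subspace_continuousP => u; rewrite /= in_itv /= => /andP[su ut].
have FF : Filter (within `[s, t] (nbhs u)) by exact: within_filter.
have xu : x w @[w --> within `[s, t] (nbhs u)] --> x u.
  move=> B /(has_derivative_within_cvg (dx u (le_trans s0 su))) uB.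
  rewrite /nbhs /= /within /= in uB *.
  apply: (filterS _ uB) => w wB /= swt; apply: wB; move: swt.
  by rewrite /= !in_itv /= andbT => /andP[sw _]; exact: le_trans sw.
rewrite /from_subspace /GRing.exp /=; apply: cvgM; apply: cvg_norm;
by apply: cvgB => //; exact: cvg_cst.
Qed.

Lemma sqr_dist_mean_value (s t : R) (v : R -> H) p : 0 <= s -> s < t ->
  (forall u, 0 <= u -> has_derivative_within `[0, +oo[ x u (v u)) ->
  exists2 c, s < c < t &
    `|x t - p| ^+ 2 - `|x s - p| ^+ 2 = 2 * ip (v c) (x c - p) * (t - s).
Proof.
move=> s0 st dx.
have dg u : u \in `]s, t[%R ->
    is_derive u 1 (fun w => `|x w - p| ^+ 2) (2 * ip (v u) (x u - p)).
  rewrite in_itv /= => /andP[su _].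
  by apply: is_derive_sqr_dist; [lra | apply: dx; lra].
have [c] := MVT st dg (within_continuous_sqr_dist s0 dx).
by rewrite in_itv /= => ? ?; exists c.
Qed.

End curve.


(** * Closedness of the graph of a maximal monotone operator *)

Section maximal_monotone_zeros.
Context {R : realType} {H : completeNormedModType R}.
Context {ip : {dot H for idfun}} (Hip : norm_from_inner ip).

(** Monotonicity passes to the limit, so adding the pair (q, 0) to the graph of A
    keeps it monotone; maximality puts this pair in the graph. *)
Lemma zeros_approx (A : H -> set H) q : maximal_monotone ip A ->
  (forall e : R, 0 < e -> exists z u, [/\ A z u, `|z - q| < e & `|u| < e]) ->
  zeros A q.
Proof.
move=> [monoA maxA] approx.
have key y v : A y v -> 0 <= ip v (y - q).
  move=> Ayv; apply/ler_addgt0Pr => d d0.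
  (* Replacing (z, u) with (q, 0) costs at most e K. *)
  pose K := `|v| + `|y - q| + 1.
  have K0 : 0 < K by rewrite ltr_wpDl ?addr_ge0.
  pose e := Num.min 1 (d / K).
  have e0 : 0 < e by rewrite lt_min ltr01 divr_gt0.
  have eK : e * K <= d by rewrite -ler_pdivlMr// ge_min lexx orbT.
  have e1 : e <= 1 by rewrite ge_min lexx.
  have [z [u [Azu zq ue]]] := approx e e0.
  have := monoA _ _ _ _ Azu Ayv.
  have -> : ip (v - u) (y - z) = ip v (y - q) + ip v (q - z) + ip (- u) (y - z).
    by rewrite linearBl linearNl !linearB /=; ring.
  have := ip_le_norm Hip v (q - z).
  have := ip_le_norm Hip (- u) (y - z).
  rewrite normrN distrC => u_yz.
  rewrite [`|q - z|]distrC => v_qz.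
  have yz : `|z - y| <= `|y - q| + e.
    by rewrite distrC; have := ler_distD q y z; rewrite [`|q - z|]distrC; lra.
  have := normr_ge0 u; have := normr_ge0 v; have := normr_ge0 (z - y).
  rewrite /K in eK; nra.
apply: (maxA (fun a b => A a b \/ (a = q /\ b = 0))); last by right.
- move=> a1 a2 b1 b2 [A1|[-> ->]] [A2|[-> ->]].
  + exact: monoA.
  + by rewrite sub0r -(opprB a1 q) linearNl linearN /= opprK; exact: key.
  + by rewrite subr0; exact: key.
  + by rewrite subrr linear0l.
- by move=> a b; left.
Qed.

End maximal_monotone_zeros.

(** * Fejer monotone curves *)

Section fejer.
Context {R : realType} {H : completeNormedModType R}.
Context {ip : {dot H for idfun}} (Hip : norm_from_inner ip).

Definition fejer_monotone (x : R -> H) (S : set H) : Prop :=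
  forall p s t, S p -> 0 <= s -> s <= t -> `|x t - p| <= `|x s - p|.

Variables (x : R -> H) (S : set H).
Hypothesis fejer_x : fejer_monotone x S.

Lemma fejer_cvg q : S q ->
  (forall e : R, 0 < e -> exists2 t, 0 <= t & `|x t - q| < e) ->
  x t @[t --> +oo] --> q.
Proof.
move=> Sq approx; apply/cvgrPdist_lt => e /approx[s s0 xs]; near=> t.
rewrite distrC; apply: le_lt_trans xs; apply: (fejer_x Sq s0).
by near: t; exact/nbhs_pinfty_ge/num_real.
Unshelve. all: by end_near. Qed.

(** Compare the distances to p and to the point q of the ball at distance r
    from p, in the direction opposite to w = x t - x s: expanding the squares,
    |x - q|^2 differs from |x - p|^2 by a constant and by 2 r <x - p, w> / |w|,
    which grows by 2 r |w| between s and t. *)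
Lemma fejer_displacement p (r s t : R) : 0 <= r ->
  (forall q, `|q - p| <= r -> S q) -> 0 <= s -> s <= t ->
  2 * r * `|x t - x s| <= `|x s - p| ^+ 2 - `|x t - p| ^+ 2.
Proof.
move=> r0 ballS s0 st; pose w := x t - x s.
have [w0|w0] := eqVneq w 0.
  have -> : x t = x s by apply/eqP; rewrite -subr_eq0 -/w w0.
  by rewrite !subrr normr0 mulr0.
have nw : 0 < `|w| by rewrite normr_gt0.
pose k := r / `|w|.
have kw : k * `|w| = r by rewrite /k divfK// gt_eqF.
have k0 : 0 <= k by rewrite divr_ge0.
have Sq : S (p - k *: w).
  by apply: ballS; rewrite addrC addKr normrN normrZ ger0_norm// kw.
have := fejer_x Sq s0 st.
have E v : x v - (p - k *: w) = (x v - p) + k *: w.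
  by rewrite opprB addrA addrAC.
rewrite !E -ler_sqr ?nnegrE// !(sqr_normD Hip) !linearZ /=.
have : ip (x t - p) w - ip (x s - p) w = `|w| ^+ 2.
  by rewrite -linearBl opprB addrA subrK (sqr_norm Hip).
rewrite -/w => ipw le_dist.
have : k * (ip (x t - p) w - ip (x s - p) w) = r * `|w|.
  by rewrite ipw expr2 mulrA kw.
lra.
Qed.

(** The displacement is controlled by the oscillation of a nonincreasing
    function bounded below, so the curve is Cauchy. *)
Lemma fejer_interior_cvg : S° !=set0 -> exists q : H, x t @[t --> +oo] --> q.
Proof.
move=> [p /nbhs_ballP[r /= r0 ballS]].
have rS q : `|q - p| <= r / 2 -> S q.
  move=> qp; apply: ballS; rewrite -ball_normE /= distrC.
  by apply: le_lt_trans qp _; rewrite ltr_pdivrMr// ltr_pMr// ltr1n.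
pose D := [set `|x t - p| ^+ 2 | t in [set t : R | 0 <= t]].
have infD : has_inf D.
  split; first by exists (`|x 0 - p| ^+ 2), 0 => //=.
  by exists 0 => _ [t _ <-]; rewrite exprn_ge0.
suff : cvg (x t @[t --> +oo]) by move=> /cvg_ex.
apply/cauchy_cvgP/cauchy_exP => e e0.
have [_ [s /= s0 <-] Ds] := inf_adherent (mulr_gt0 r0 e0) infD.
exists (x s); near=> t; rewrite -ball_normE /= distrC.
have st : s <= t by near: t; exact/nbhs_pinfty_ge/num_real.
have r2 : 0 <= r / 2 by lra.
have := fejer_displacement r2 rS s0 st.
have : inf D <= `|x t - p| ^+ 2.
  by apply: ge_inf; [exact: infD.2 | exists t => //=; exact: le_trans st].
have -> : 2 * (r / 2) = r by field.
rewrite -(ltr_pM2l r0); lra.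
Unshelve. all: by end_near. Qed.

End fejer.

(** * Decrease of the distances to the zeros along a solution *)

Section trajectory.
Context {R : realType} {H : completeNormedModType R}.
Context {ip : {dot H for idfun}} (Hip : norm_from_inner ip).
Variables (A : H -> set H) (theta : R) (x0 : H) (x : R -> H) (lambda : R -> R).
Hypotheses (monoA : monotone_operator ip A) (theta_gt0 : 0 < theta).
Hypotheses (sol : global_solution A theta x0 x lambda).

(** Eliminates lambda from the system: with u = - dx t / lambda t, the constraint
    lambda |dx t| = theta becomes theta |u| = |dx t|^2, and monotonicity between
    the pairs (x t + dx t, u) and (p, 0) gives the dissipation inequality. *)
Lemma solution_velocity : exists2 dx : R -> H,
  forall t, 0 <= t -> has_derivative_within `[0, +oo[ x t (dx t) &
  forall t, 0 <= t -> exists u, [/\ A (x t + dx t) u,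
    theta * `|u| = `|dx t| ^+ 2 &
    forall p, zeros A p -> ip (dx t) (x t - p) <= - `|dx t| ^+ 2].
Proof.
have [[dx [dxP _ eq_x]] _ _] := sol; exists dx => // t t0.
have [lam0 [z [[u Azu xzu] dxz lamz]]] := eq_x t t0.
have zE : x t + dx t = z by apply/eqP; rewrite addrC -subr_eq0 dxz.
have dxE : dx t = - (lambda t *: u).
  by apply: (addrI (x t)); rewrite zE xzu addrK.
exists u; rewrite zE; split => //.
- rewrite -lamz -zE addrAC subrr add0r mulrAC.
  by rewrite expr2; congr (_ * _); rewrite dxE normrN normrZ gtr0_norm.
- move=> p Sp; have := monoA Sp Azu; rewrite subr0 => uz.
  have -> : x t - p = (z - p) - dx t by rewrite -zE addrAC addrK.
  rewrite linearB /= -(sqr_norm Hip) {1}dxE linearNl linearZl_LR /=.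
  by rewrite /GRing.scale /=; have := mulr_ge0 (ltW lam0) uz; lra.
Qed.

Lemma solution_fejer : fejer_monotone x (zeros A).
Proof.
have [dx dxP velo] := solution_velocity.
move=> p s t Sp s0; rewrite le_eqVlt => /predU1P[->//|st].
have [c /andP[sc _] eq_c] := sqr_dist_mean_value Hip p s0 st dxP.
have [|u [_ _ /(_ _ Sp) le_ip]] := velo c; first lra.
rewrite -ler_sqr ?nnegrE// -subr_le0 eq_c pmulr_lle0 ?subr_gt0//.
by rewrite pmulr_rle0//; apply: le_trans le_ip _; rewrite oppr_le0 exprn_ge0.
Qed.

(** On an interval of length L, a speed of at least d would decrease |x - p|^2 by
    2 d^2 L, which exceeds its initial value when L is large. *)
Lemma solution_approx_zeros : zeros A !=set0 -> forall e T : R, 0 < e ->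
  exists t z u,
    [/\ 0 <= t, T <= t, A z u, `|z - x t| < e & `|u| < e].
Proof.
move=> [p Sp] e T e0; have [dx dxP velo] := solution_velocity.
(* A speed below d <= 1 gives theta |u| = |dx|^2 <= |dx| < theta e. *)
pose d := Num.min e (Num.min 1 (theta * e)).
have d0 : 0 < d by rewrite !lt_min e0 ltr01 mulr_gt0.
pose s := Num.max 0 T; pose L := `|x s - p| ^+ 2 / d ^+ 2 + 1.
have s0 : 0 <= s by rewrite le_max lexx.
have Ts : T <= s by rewrite le_max lexx orbT.
have L0 : 0 < L by rewrite ltr_wpDl// divr_ge0 ?exprn_ge0// ltW.
have sL : s < s + L by lra.
have [c /andP[sc _] eq_c] := sqr_dist_mean_value Hip p s0 sL dxP.
have [|u [Au thu /(_ _ Sp) le_ip]] := velo c; first lra.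
have dx_d : `|dx c| < d.
  rewrite ltNge; apply/negP => d_dx.
  have dL : d ^+ 2 * L = `|x s - p| ^+ 2 + d ^+ 2.
    by rewrite mulrDr mulr1 mulrC divfK// gt_eqF// exprn_gt0.
  have : d ^+ 2 * L <= `|dx c| ^+ 2 * L.
    by rewrite ler_pM2r// ler_sqr ?nnegrE// ltW.
  have : ip (dx c) (x c - p) * L <= - `|dx c| ^+ 2 * L by rewrite ler_pM2r.
  have : 0 < d ^+ 2 by rewrite exprn_gt0.
  have : 0 <= `|x (s + L) - p| ^+ 2 by rewrite exprn_ge0.
  have : 0 <= `|x s - p| ^+ 2 by rewrite exprn_ge0.
  move: eq_c; rewrite addrAC subrr add0r; lra.
move: (dx_d); rewrite !lt_min => /and3P[dx_e dx_1 dx_te].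
exists c, (x c + dx c), u; split => //; try lra.
- by rewrite addrAC subrr add0r.
- rewrite -(ltr_pM2l theta_gt0) thu; apply: le_lt_trans dx_te.
  by rewrite expr2 ler_piMl// ltW.
Qed.

End trajectory.

(** * Strong convergence *)

Lemma subdifferential_le (R : realType) (H : completeNormedModType R)
    (ip : {dot H for idfun}) (Hip : norm_from_inner ip) (f : H -> \bar R)
    (p z u : H) (m e : R) : f p = m%:E -> subdifferential ip f z u ->
  `|u| * `|p - z| <= e -> (f z <= (m + e)%:E)%E.
Proof.
move=> fp /(_ p); rewrite fp => le_f ue.
have := ip_le_norm Hip (- u) (p - z); rewrite normrN linearNl => le_ip.
case: (f z) le_f => [r| |] le_f; last exact: leNye.
  by move: le_f; rewrite -EFinD !lee_fin; lra.
by move: le_f; rewrite addye.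
Qed.

Theorem theorem3p5 (R : realType) (H : completeNormedModType R)
    (ip : {dot H for idfun}) (Hip : norm_from_inner ip)
    (A : H -> set H) (HA : maximal_monotone ip A)
    (theta : R) (theta_gt0 : 0 < theta)
    (S_neq0 : zeros A !=set0)
    (x0 : H) (x0S : ~ zeros A x0)
    (x : R -> H) (lambda : R -> R)
    (sol : global_solution A theta x0 x lambda) :
  let converges_to_zero :=
    exists2 xs : H, zeros A xs & x t @[t --> +oo] --> xs in
  [/\ strongly_monotone ip A -> converges_to_zero,
      forall f : H -> \bar R,
        proper_function f -> lower_semicontinuous f -> convex_ereal f ->
        boundedly_inf_compact f -> A = subdifferential ip f ->
        converges_to_zero &
      (zeros A)° !=set0 -> converges_to_zero].
Proof.
have fejer := solution_fejer Hip HA.1 sol.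
have approx := solution_approx_zeros Hip HA.1 theta_gt0 sol S_neq0.
split.
- (* u controls the distance from z to the zero p. *)
  move=> [alpha alpha0 strongA]; have [p Sp] := S_neq0; exists p => //.
  apply: (fejer_cvg fejer Sp) => e e0.
  pose d := Num.min (e / 2) (alpha * (e / 2)).
  have e2 : 0 < e / 2 by lra.
  have d0 : 0 < d by rewrite lt_min e2 mulr_gt0.
  have [t [z [u [t0 _ Azu zx ud]]]] := approx d 0 d0; exists t => //.
  move: zx ud; rewrite !lt_min => /andP[zx _] /andP[_ ud].
  have := strongA _ _ _ _ Sp Azu; rewrite subr0 => strong_zp.
  have zp : alpha * `|z - p| <= `|u|.
    have [zp0|zp0] := eqVneq `|z - p| 0; first by rewrite zp0 mulr0.
    have zp_gt0 : 0 < `|z - p| by rewrite lt_def zp0 normr_ge0.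
    rewrite -(ler_pM2r zp_gt0) -mulrA -expr2.
    exact: le_trans strong_zp (ip_le_norm Hip _ _).
  have : `|z - p| < e / 2.
    by rewrite -(ltr_pM2l alpha0); exact: le_lt_trans ud.
  have := ler_distD z (x t) p; rewrite [`|x t - z|]distrC; lra.
- move=> f [f_gtNy [y fy]] _ _ f_infc Af; have [p Sp] := S_neq0.
  (* p minimizes f, which is finite somewhere. *)
  have [m fp] : exists m, f p = m%:E.
    move: Sp (f_gtNy p) fy; rewrite Af /zeros /subdifferential /= => /(_ y).
    rewrite linear0l adde0; case: (f p) => [m| |] //; first by exists m.
    by rewrite leye_eq => /eqP ->.
  pose e n : R := n.+1%:R^-1.
  have e_gt0 n : 0 < e n by rewrite invr_gt0.
  have e_le1 n : e n <= 1 by rewrite invf_le1// ler1n.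
  have /choice[tzu tzuP] : forall n, exists a : R * (H * H),
      [/\ 0 <= a.1, A a.2.1 a.2.2, `|a.2.1 - x a.1| < e n & `|a.2.2| < e n].
    move=> n; have [t [z [u [t0 _ Azu zx ue]]]] := approx _ 0 (e_gt0 n).
    by exists (t, (z, u)).
  pose t n := (tzu n).1; pose z n := (tzu n).2.1; pose u n := (tzu n).2.2.
  pose r := `|x 0 - p| + 1.
  have zp n : `|z n - p| <= r.
    have [t0 _ zx _] := tzuP n.
    have := fejer _ _ _ Sp (lexx 0) t0; have := e_le1 n.
    have := ler_distD (x (t n)) (z n) p; rewrite /r /z /t; lra.
  (* The slack r in the level absorbs |u| |p - z|, since |u| <= 1. *)
  pose C := [set a : H | (f a <= (m + r)%:E)%E /\ `|a| <= r + `|p|].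
  have Cz n : C (z n).
    have [_ Azu _ ue] := tzuP n; split.
      rewrite Af in Azu; apply: (subdifferential_le Hip fp Azu).
      rewrite distrC -[r]mul1r ler_pM ?zp//.
      exact: le_trans (ltW ue) (e_le1 n).
    have := ler_normD (z n - p) p; rewrite subrK; have := zp n; lra.
  have r0 : 0 < r + `|p|.
    by rewrite /r; have := normr_ge0 p; have := normr_ge0 (x 0 - p); lra.
  have := f_infc _ (m + r) r0; rewrite precompactE -/C => compC.
  have [|q [_ clq]] := compC (z @ \oo) _.
    by exists 0%N => // n _; apply: subset_closure.
  have near_q d : 0 < d -> exists n, `|z n - q| < d /\ e n < d.
    move=> d0.
    have [||_ [[n /= nd <-]]] := clq (z @` [set n | e n < d]) (ball q d).
    - by apply: filterS (near_infty_natSinv_lt (PosNum d0)) => n; exists n.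
    - exact: nbhsx_ballx.
    by rewrite -ball_normE /= distrC => zq; exists n.
  have Sq : zeros A q.
    apply: (zeros_approx Hip HA) => d /near_q[n [zq nd]].
    have [_ Azu _ ue] := tzuP n.
    by exists (z n), (u n); split => //; exact: lt_trans nd.
  exists q => //; apply: (fejer_cvg fejer Sq) => d d0.
  have [|n [zq nd]] := near_q (d / 2); first lra.
  have [t0 _ zx _] := tzuP n; exists (t n) => //.
  have := ler_distD (z n) (x (t n)) q.
  rewrite [`|x (t n) - z n|]distrC; rewrite /z /t in zq *; lra.
- move=> Sint; have [q xq] := fejer_interior_cvg Hip fejer Sint.
  exists q => //; apply: (zeros_approx Hip HA) => d d0.
  have d2 : 0 < d / 2 by lra.
  have [T [_ Tq]] := (cvgrPdist_lt _ _).1 xq _ d2.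
  have [t [z [u [t0 Tt Azu zx ud]]]] := approx (d / 2) (T + 1) d2.
  exists z, u; split => //; last lra.
  have := Tq t; rewrite /= distrC => /(_ _) xtq.
  have : `|x t - q| < d / 2 by apply: xtq; lra.
  have := ler_distD (x t) z q; lra.
Qed.
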